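(* For every integer $n\geq 0$ and indeterminate $y$, $$\sum_{k=0}^{n}(-1)^{n-k}\binom{n}{k}A_{n,k}(y+1)^{k}=\sum_{k=0}^{n}\binom{n}{k}y^{k}B_{k},$$ or equivalently $$\sum_{k=0}^{n}\binom{n}{k}A_{n,k}y^{k}=\sum_{k=0}^{n}(-1)^{n-k}\binom{n}{k}(y+1)^{k}B_{k}.$$
   Context: A partition of a finite set is a collection of nonempty, pairwise disjoint subsets (blocks) whose union is the set; a singleton of a partition is a block with exactly one element. $B_n$ denotes the $n$-th Bell number ($B_0=1$). For integers $0\leq k\leq n$, $A_{n,k}$ denotes the number of partitions of $\{1,2,\dots,n+1\}$ whose largest singleton is $k+1$ (i.e. $\{k+1\}$ is a block and no $j>k+1$ forms a singleton block). *)

(* Defs.v *)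
From mathcomp Require Import all_boot all_order all_algebra.

Set Implicit Arguments.
Unset Strict Implicit.
Unset Printing Implicit Defensive.

Definition set_partitions (T : finType) : {set {set {set T}}} :=
  [set P : {set {set T}} | partition P [set: T]].

Definition bell (n : nat) : nat := #|set_partitions 'I_n|.

(* The ground set {1, ..., n+1} is represented by 'I_n.+1, the ordinal of value
   i standing for the element i+1; so k below stands for the element k+1. *)
Definition largest_singleton (n : nat) (P : {set {set 'I_n.+1}})
    (k : 'I_n.+1) : bool :=
  ([set k] \in P) && [forall j : 'I_n.+1, (k < j) ==> ([set j] \notin P)].

Definition A (n : nat) (k : 'I_n.+1) : nat :=
  #|[set P in set_partitions 'I_n.+1 | largest_singleton P k]|.

(* Main.v *)
Require Import Defs.
From HB Require Import structures.
From mathcomp Require Import all_boot all_order all_algebra.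
From mathcomp Require Import ring.
Import GRing.Theory.
Local Open Scope ring_scope.

Set Implicit Arguments.
Unset Strict Implicit.
Unset Printing Implicit Defensive.

(** Let L be the linear functional on polynomials sending 'X^m to the Bell
    number B_m, and count partitions in which certain singletons are forbidden.
    Forbidding {x} too discards the partitions that have it as a block, which
    amount to partitions of the ground set without x; under L, this replaces a
    factor 'X by 'X - 1. Deleting the block {k+1} leaves n elements, the n - k
    largest of which may not be singletons: A_(n,k) = L('X^k ('X - 1)^(n-k)).
    Both identities follow by applying L to the two binomial expansions of
    (x ('X - 1) + z 'X)^n = (- x + (z + x) 'X)^n. *)

Lemma imset_preimset (aT rT : finType) (f : aT -> rT) (B : {set rT}) :
  B \subset codom f -> f @: (f @^-1: B) = B.
Proof.
move=> /subsetP sBf; apply/setP => y; apply/imsetP/idP => [[x]|By].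
  by rewrite inE => fxB ->.
by have /codomP[x yE] := sBf y By; exists x; rewrite // inE -yE.
Qed.

Lemma card_partitions_imset (aT rT : finType) (f : aT -> rT) (D : {set aT}) :
  injective f ->
  #|[set P | partition P (f @: D)]| = #|[set P | partition P D]|.
Proof.
move=> f_inj; pose fB (B : {set aT}) := f @: B.
have fBP_inj : injective (fun P : {set {set aT}} => fB @: P).
  exact: imset_inj (imset_inj f_inj).
rewrite -[RHS](card_imset _ fBP_inj).
have -> : [set P | partition P D]
    = (fun P : {set {set aT}} => fB @: P) @^-1: [set P | partition P (f @: D)].
  by apply/setP => P; rewrite !inE imset_partition.
rewrite imset_preimset //; apply/subsetP => P; rewrite inE => partP.
apply/codomP; exists (fB @^-1: P); rewrite imset_preimset //.
apply/subsetP => B /(partitionS partP) sBfD.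
apply/codomP; exists (f @^-1: B); rewrite /fB imset_preimset //.
apply: subset_trans sBfD _.
by apply/subsetP => _ /imsetP[x _ ->]; apply: codom_f.
Qed.

Lemma card_partitions (T : finType) (D : {set T}) :
  #|[set P | partition P D]| = bell #|D|.
Proof.
have {1}-> : D = enum_val @: [set: 'I_#|D|].
  apply/setP => x; apply/idP/imsetP => [Dx|[i _ ->]]; last exact: enum_valP.
  by exists (enum_rank_in Dx x); rewrite ?inE ?enum_rankK_in.
by rewrite (card_partitions_imset _ enum_val_inj).
Qed.

Lemma card_partitions_block (T : finType) (D B : {set T})
    (phi : pred {set {set T}}) :
    B != set0 -> B \subset D ->
  #|[set P | [&& partition P D, B \in P & phi (P :\ B)]]|
    = #|[set Q | partition Q (D :\: B) & phi Q]|.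
Proof.
move=> B0 sBD.
have notin_block Q : partition Q (D :\: B) -> B \notin Q.
  move=> partQ; apply/negP => /(partitionS partQ).
  by rewrite subsetD -setI_eq0 setIid (negbTE B0) andbF.
have addB_inj : {in [set Q | partition Q (D :\: B) & phi Q] &,
    injective (fun Q => B |: Q)}.
  move=> Q1 Q2; rewrite !inE.
  case/andP=> /notin_block BQ1 _ /andP[/notin_block BQ2 _] eqBQ.
  by rewrite -(setU1K BQ1) eqBQ setU1K.
rewrite -(card_in_imset addB_inj); apply: eq_card => P.
apply/idP/imsetP => [|[Q]]; rewrite !inE.
  case/and3P=> partP BP phiP; exists (P :\ B); last by rewrite setD1K.
  by rewrite inE partitionD1.
case/andP=> partQ phiQ ->; rewrite setU11 setU1K ?notin_block // phiQ !andbT.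
rewrite -[X in partition _ X](setID D B) (setIidPr sBD).
by apply: partitionU1 => //; rewrite disjoint_sym disjoints_subset subsetDr.
Qed.

Definition singleton_free (T : finType) (E : {set T}) (P : {set {set T}}) :=
  [forall x in E, [set x] \notin P].

Definition singleton_free_partitions (T : finType) (D E : {set T}) :=
  [set P | partition P D & singleton_free E P].

Section SingletonFree.

Variables (T : finType) (D E : {set T}) (x : T).

Lemma singleton_freeU1 (P : {set {set T}}) :
  singleton_free (x |: E) P = ([set x] \notin P) && singleton_free E P.
Proof.
apply/forall_inP/andP => [freeP|[xP /forall_inP freeP] z /setU1P[->|/freeP] //].
split; first by apply: freeP; rewrite setU11.
by apply/forall_inP => z Ez; apply: freeP; rewrite setU1r.
Qed.

Hypothesis Ex : x \notin E.

Lemma singleton_freeD1 (P : {set {set T}}) :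
  singleton_free E (P :\ [set x]) = singleton_free E P.
Proof.
apply: eq_forallb_in => z Ez; rewrite !inE (inj_eq set1_inj).
suff -> : z != x by [].
by apply: contraNneq Ex => <-.
Qed.

Hypothesis Dx : x \in D.

Lemma card_singleton_free_partitions_block1 :
  #|[set P in singleton_free_partitions D E | [set x] \in P]|
    = #|singleton_free_partitions (D :\ x) E|.
Proof.
rewrite -card_partitions_block ?sub1set //; last first.
  by apply/set0Pn; exists x; rewrite inE.
apply: eq_card => P; rewrite !inE singleton_freeD1.
by rewrite -andbA [X in _ && X]andbC.
Qed.

Lemma card_singleton_free_partitionsU1 :
  #|singleton_free_partitions D E|
    = (#|singleton_free_partitions (D :\ x) E|
       + #|singleton_free_partitions D (x |: E)|)%N.
Proof.
rewrite -card_singleton_free_partitions_block1.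
rewrite -(cardsID [set P : {set {set T}} | [set x] \in P]).
congr (_ + _)%N; apply: eq_card => P; rewrite !inE // singleton_freeU1.
by rewrite andbCA.
Qed.

End SingletonFree.

Definition umbral (R : nzSemiRingType) (a : nat -> R) (p : {poly R}) : R :=
  \sum_(i < size p) p`_i * a i.

Section Umbral.

Variables (R : nzSemiRingType) (a : nat -> R).

Lemma umbral_wide (n : nat) (p : {poly R}) :
  (size p <= n)%N -> umbral a p = \sum_(i < n) p`_i * a i.
Proof.
move=> le_pn; rewrite /umbral (big_ord_widen n (fun i => p`_i * a i)) //.
rewrite big_mkcond; apply: eq_bigr => i _.
by case: ltnP => // /(nth_default 0)->; rewrite mul0r.
Qed.

Lemma umbralZ : scalable_for *%R (umbral a).
Proof.
move=> c p; rewrite (umbral_wide (size_scale_leq c p)) mulr_sumr.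
by apply: eq_bigr => i _; rewrite coefZ mulrA.
Qed.

Lemma umbralD : {morph umbral a : p q / p + q}.
Proof.
move=> p q; rewrite (umbral_wide (size_polyD p q)).
rewrite (umbral_wide (leq_maxl (size p) (size q))).
rewrite (umbral_wide (leq_maxr (size p) (size q))) -big_split /=.
by apply: eq_bigr => i _; rewrite coefD mulrDl.
Qed.

HB.instance Definition _ :=
  GRing.isSemilinear.Build R {poly R} R *%R (umbral a) (umbralZ, umbralD).

Lemma umbralXn (n : nat) : umbral a 'X^n = a n.
Proof.
rewrite /umbral size_polyXn big_ord_recr /= coefXn eqxx mul1r.
rewrite big1 ?add0r // => i _.
by rewrite coefXn ltn_eqF ?mul0r.
Qed.

End Umbral.

Local Notation bell_umbral R := (@umbral R (fun m => (bell m)%:R)).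

Lemma card_singleton_free_partitions (R : nzRingType) (T : finType)
    (D E : {set T}) :
  E \subset D ->
  (#|singleton_free_partitions D E|)%:R
    = bell_umbral R ('X ^+ #|D :\: E| * ('X - 1) ^+ #|E|).
Proof.
have [e] := ubnP #|E|; elim: e D E => // e IH D E ltEe sED.
have [->|[x Ex]] := set_0Vmem E.
  rewrite cards0 expr0 mulr1 setD0 umbralXn -card_partitions.
  congr _%:R; apply: eq_card => P; rewrite !inE andb_idr // => _.
  by apply/forall_inP => x; rewrite inE.
have Dx := subsetP sED x Ex.
have notinE : x \notin E :\ x by rewrite !inE eqxx.
have ltEx : (#|E :\ x| < e)%N by move: ltEe; rewrite (cardsD1 x) Ex.
have cardDEx : #|D :\: (E :\ x)| = #|D :\: E|.+1.
  rewrite (cardsD1 x) !inE eqxx Dx setDDl; congr (_ + #|pred_of_set _|)%N.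
  by rewrite setUC setD1K.
have := card_singleton_free_partitionsU1 notinE Dx; rewrite setD1K //.
move/(congr1 (fun m => m%:R : R)); rewrite natrD => /(canLR (addKr _))<-.
rewrite !IH ?setSD // ?(subset_trans (subsetDl _ _)) // cardDEx.
rewrite setDDl setD1K // [#|E|](cardsD1 x) Ex.
rewrite addrC -linearB /=; congr umbral.
by rewrite exprSr exprS -mulrBl mulrA mulrBr mulr1.
Qed.

Lemma card_ord_lt (n m : nat) : (m <= n)%N -> #|[set j : 'I_n | (j < m)%N]| = m.
Proof.
move=> le_mn; rewrite -sum1dep_card -(big_ord_widen n (fun=> 1%N)) //.
by rewrite sum1_card card_ord.
Qed.

Lemma A_umbral (R : nzRingType) (n : nat) (k : 'I_n.+1) :
  (A k)%:R = bell_umbral R ('X ^+ k * ('X - 1) ^+ (n - k)).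
Proof.
pose E := [set j : 'I_n.+1 | (k < j)%N].
have notinE : k \notin E by rewrite inE ltnn.
have -> : A k = #|singleton_free_partitions ([set: 'I_n.+1] :\ k) E|.
  rewrite -(card_singleton_free_partitions_block1 notinE (in_setT k)).
  apply: eq_card => P; rewrite !inE /largest_singleton -[RHS]andbA.
  congr (_ && _); rewrite andbC; congr (_ && _).
  by apply: eq_forallb => j; rewrite inE.
have cardE : #|E| = (n - k)%N.
  have -> : E = ~: [set j : 'I_n.+1 | (j < k.+1)%N].
    by apply/setP => j; rewrite !inE -leqNgt.
  by rewrite cardsCs setCK card_ord_lt ?card_ord // subSS.
rewrite card_singleton_free_partitions ?subsetD1 ?subsetT // cardE.
have -> : [set: 'I_n.+1] :\ k :\: E = [set j : 'I_n.+1 | (j < k)%N].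
  by apply/setP => j; rewrite !inE andbT -leqNgt andbC -ltn_neqAle.
by rewrite card_ord_lt // ltnW.
Qed.

Lemma scalar_exprD (R : comNzSemiRingType) (V : comSemiAlgType R)
    (phi : {scalar V}) (c d : R) (u v : V) (n : nat) :
  phi ((c *: u + d *: v) ^+ n)
    = \sum_(k < n.+1) c ^+ (n - k) * 'C(n, k)%:R * d ^+ k
                       * phi (u ^+ (n - k) * v ^+ k).
Proof.
rewrite exprDn linear_sum; apply: eq_bigr => k _.
rewrite !exprZn -scalerAl -scalerAr linearMn !linearZ /=.
by rewrite -[LHS]mulr_natl; ring.
Qed.

Lemma sum_A_bell (R : comNzRingType) (n : nat) (x z : R) :
  \sum_(k < n.+1) x ^+ (n - k) * 'C(n, k)%:R * (A k)%:R * z ^+ k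
    = \sum_(k < n.+1)
        (- x) ^+ (n - k) * 'C(n, k)%:R * (z + x) ^+ k * (bell k)%:R.
Proof.
transitivity (bell_umbral R ((x *: ('X - 1) + z *: 'X) ^+ n)).
  rewrite scalar_exprD; apply: eq_bigr => k _.
  by rewrite A_umbral [_ * 'X^k]mulrC mulrAC.
have -> : x *: ('X - 1) + z *: 'X = (- x) *: 1 + (z + x) *: 'X :> {poly R}.
  by rewrite scalerBr scalerDl scaleNr addrAC addrC (addrC (x *: _)).
rewrite scalar_exprD; apply: eq_bigr => k _.
by rewrite expr1n mul1r /= umbralXn.
Qed.

Theorem theorem3p1 (n : nat) :
  (\sum_(k < n.+1)
      (-1) ^+ (n - k) * 'C(n, k)%:R * (A k)%:R * ('X + 1) ^+ k
     = \sum_(k < n.+1) 'C(n, k)%:R * 'X ^+ k * (bell k)%:R :> {poly int})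
  /\
  (\sum_(k < n.+1) 'C(n, k)%:R * (A k)%:R * 'X ^+ k
     = \sum_(k < n.+1)
         (-1) ^+ (n - k) * 'C(n, k)%:R * ('X + 1) ^+ k * (bell k)%:R
       :> {poly int}).
Proof.
split.
  rewrite (sum_A_bell _ (-1) ('X + 1)); apply: eq_bigr => k _.
  by rewrite opprK addrK expr1n mul1r.
rewrite -(sum_A_bell _ 1 'X); apply: eq_bigr => k _.
by rewrite expr1n mul1r.
Qed.
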